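(* In the setting of the context, for $j=0,\dots,N$ let $L(j)\in M_n(\mathbb C)$ be the alternant matrix $$L(j)_{i,\ell}=p_{i-1}(\mu_{nj+\ell-1}),\qquad i,\ell=1,\dots,n.$$ If $\mu_i\ne\mu_j$ for all $i\neq j$, then the following hold: 1. The matrix $L(j)$ is invertible. 2. The family $(\theta_j)_j$ is given by $\theta_j=L(j)\,\alpha_j\,L(j)^{-1}$, and it satisfies the Vandermonde condition. 3. The weight $W(j)=(e_0,\Phi_j)(e_0,\Phi_j)^*$ decomposes as $W(j)=L(j)D(j)L(j)^*$, where $D(j)=\operatorname{diag}(w_{nj},\dots,w_{nj+n-1})$. 4. The matrix valued polynomials $R_k$, $k=0,\dots,N$, defined by $R_k(j)_{i,\ell}=p_{nk+i-1}(\mu_{nj+\ell-1})$, $i,\ell=1,\dots,n$, satisfy the orthogonality relation $\sum_{j=0}^N R_k(j)D(j)R_m(j)^*=\delta_{k,m}I_n$. 5. The polynomials $\Pi_k(x)$ satisfy $\Pi_k(\theta_j)=R_k(j)L(j)^{-1}$.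
   Context: $A^*$ is the conjugate transpose (complex conjugate for scalars). $V$ is a complex vector space of dimension $n(N+1)$ with a positive definite Hermitian inner product $\langle\cdot,\cdot\rangle$, linear in the first argument. $|k\rangle$, $k=0,\dots,n(N+1)-1$, is an orthonormal basis of $V$ (the eigenbasis of a self-adjoint operator $H$), and $P$ is a self-adjoint operator on $V$ with $$P|k\rangle=a_{k+1}^*|k+1\rangle+b_k|k\rangle+a_k|k-1\rangle,\qquad |-1\rangle=|n(N+1)\rangle=0,$$ with $a_k\neq0$ for $1\le k\le n(N+1)-1$. $|\phi_j\rangle$, $j=0,\dots,n(N+1)-1$, is an orthonormal basis of eigenvectors of $P$, $P|\phi_j\rangle=\mu_j|\phi_j\rangle$. Here $\langle k|\phi_j\rangle$ is the inner product of $|k\rangle$ and $|\phi_j\rangle$ (linear in $|k\rangle$). Put $w_j=|\langle0|\phi_j\rangle|^2$; phases are chosen so that $\langle 0|\phi_j\rangle=w_j^{1/2}$. The scalar orthonormal polynomials $p_k$ of degree $k$, $k=0,\dots,n(N+1)-1$, are given by $p_0=1$, $p_{-1}=0$, $a_{k+1}^*p_{k+1}(x)=(x-b_k)p_k(x)-a_kp_{k-1}(x)$; they satisfy $p_k(\mu_j)=\langle k|\phi_j\rangle w_j^{-1/2}$. $V^n$ is the left $M_n(\mathbb C)$-module with action $A(v_1,\dots,v_n)=(\sum_k a_{1k}v_k,\dots,\sum_k a_{nk}v_k)$ and matrix valued inner product $(v,w)=(\langle v_i,w_j\rangle)_{i,j}\in M_n(\mathbb C)$. An operator on $V$ acts on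 $V^n$ componentwise. For $k,j=0,\dots,N$ put $$e_k=(|nk\rangle,\dots,|nk+n-1\rangle),\quad \Phi_j=(|\phi_{nj}\rangle,\dots,|\phi_{nj+n-1}\rangle),\quad \alpha_j=\operatorname{diag}(\mu_{nj}^n,\dots,\mu_{nj+n-1}^n),$$ so $P^n\cdot\Phi_j=\alpha_j\Phi_j$ and $P^n\cdot e_k=A_{k+1}^*e_{k+1}+B_ke_k+A_ke_{k-1}$ ($e_{-1}=e_{N+1}=0$) for matrices $A_k,B_k\in M_n(\mathbb C)$ with $B_k=B_k^*$ and $A_k$ invertible for $1\le k\le N$. Standing assumption: the matrices $(e_0,\Phi_j)$, $j=0,\dots,N$, are invertible. Put $\theta_j=(e_0,\Phi_j)\alpha_j^*(e_0,\Phi_j)^{-1}$. Vandermonde condition: a family $(\theta_j)_{j=0}^N$ in $M_n(\mathbb C)$ (with $\theta_j$ an entrywise rational function of $j$ without poles in $0,\dots,N$) satisfies it if for every $k\in\{1,\dots,N\}$ the block matrix whose $(r,s)$ block is $\theta_s^r$ ($r,s=0,\dots,k$, $\theta_s^0=I_n$) is invertible. $\Pi_k(x)=\sum_{i=0}^kM_{k,i}x^i$ ($k=0,\dots,N$, $M_{k,i}\in M_n(\mathbb C)$, $M_{k,k}$ invertible, $x\in M_n(\mathbb C)$) is the unique family of matrix valued polynomials with $\Pi_0=I_n$, $\Pi_{-1}=0$ and $A_{k+1}^*\Pi_{k+1}(\theta_j)+B_k\Pi_k(\theta_j)+A_k\Pi_{k-1}(\theta_j)=\Pi_k(\theta_j)\theta_j$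 for all $j,k$ (the term with $\Pi_{N+1}$ omitted when $k=N$); equivalently $(e_k,\Phi_j)=\Pi_k(\theta_j)(e_0,\Phi_j)$. *)

(* Defs.v *)
From HB Require Import structures.
From mathcomp Require Import all_boot all_order all_algebra.
From mathcomp Require Export sesquilinear spectral.
From mathcomp Require Export complex.
From mathcomp Require Export reals.

Set Implicit Arguments.
Unset Strict Implicit.
Unset Printing Implicit Defensive.

Import Order.TTheory GRing.Theory Num.Theory.
Local Open Scope ring_scope.
Local Open Scope sesquilinear_scope.

(* f (k - 1), with the convention f (-1) = 0. *)
Definition prev_term (T : nmodType) (f : nat -> T) (k : nat) : T :=
  if k is k'.+1 then f k' else 0.

Section InnerProduct.
Variables (C : numClosedFieldType) (V : vectType C).
(* {dot V for Num.conj}: positive definite Hermitian, linear in its first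
   argument and conjugate-linear in its second. *)
Variable ip : {dot V for Num.conj}.

Definition orthonormal_basis (s : seq V) : Prop :=
  orthonormal ip s /\ basis_of fullv s.

Definition self_adjoint (T : 'End(V)) : Prop :=
  forall u v, ip (T u) v = ip u (T v).

Variable n : nat.
Implicit Types v w : {ffun 'I_n -> V}.

Definition mxact (A : 'M[C]_n) v : {ffun 'I_n -> V} :=
  [ffun i => \sum_k A i k *: v k].

Definition mxip v w : 'M[C]_n := \matrix_(i, j) ip (v i) (w j).

Definition compwise (f : V -> V) v : {ffun 'I_n -> V} := [ffun i => f (v i)].

(* The k-th block (s_{nk}, ..., s_{nk+n-1}) of s; entries beyond the end of s
   are 0, so that a block starting at the end of s is 0. *)
Definition vblock (s : seq V) (k : nat) : {ffun 'I_n -> V} :=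
  [ffun i : 'I_n => s`_(n * k + i)].

Definition eigen_mx (mu : nat -> C) (j : nat) : 'M[C]_n :=
  diag_mx (\row_(l < n) mu (n * j + l)%N ^+ n).

Definition theta_mx (ket phi : seq V) (mu : nat -> C) (j : nat) : 'M[C]_n :=
  mxip (vblock ket 0) (vblock phi j) *m (eigen_mx mu j)^t*
    *m invmx (mxip (vblock ket 0) (vblock phi j)).

Definition weight_mx (ket phi : seq V) (j : nat) : 'M[C]_n :=
  mxip (vblock ket 0) (vblock phi j) *m (mxip (vblock ket 0) (vblock phi j))^t*.

Definition weight (ket phi : seq V) (j : nat) : C := `|ip ket`_0 phi`_j| ^+ 2.

Definition weight_diag (ket phi : seq V) (j : nat) : 'M[C]_n :=
  diag_mx (\row_(l < n) weight ket phi (n * j + l)).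

End InnerProduct.

Section Polynomials.
Variables (C : numClosedFieldType) (n : nat).

(* Only p 0, ..., p d.-1 are constrained. *)
Definition scalar_polys (d : nat) (a b : nat -> C) (p : nat -> {poly C}) :
    Prop :=
  p 0 = 1 /\
  forall k, (k.+1 < d)%N ->
    (a k.+1)^* *: p k.+1 = ('X - (b k)%:P) * p k - a k *: prev_term p k.

Definition alternant (p : nat -> {poly C}) (mu : nat -> C) (j : nat) :
    'M[C]_n :=
  \matrix_(i, l) (p i).[mu (n * j + l)%N].

Definition Rmx (p : nat -> {poly C}) (mu : nat -> C) (k j : nat) : 'M[C]_n :=
  \matrix_(i, l) (p (n * k + i)%N).[mu (n * j + l)%N].

Definition Pi (M : nat -> nat -> 'M[C]_n) (k : nat) (x : 'M[C]_n) : 'M[C]_n :=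
  \sum_(i < k.+1) M k i *m x ^+ i.

Definition matrix_polys (N : nat) (A B th : nat -> 'M[C]_n)
    (M : nat -> nat -> 'M[C]_n) : Prop :=
  [/\ forall k, (k <= N)%N -> M k k \in unitmx,
      M 0 0 = 1%:M
    & forall k j, (k <= N)%N -> (j <= N)%N ->
        (if (k < N)%N then (A k.+1)^t* *m Pi M k.+1 (th j) else 0)
        + B k *m Pi M k (th j) + A k *m prev_term (fun k' => Pi M k' (th j)) k
        = Pi M k (th j) *m th j].

(* g.[j%:R] != 0 for j <= N encodes the absence of poles in 0, ..., N. *)
Definition rational_in_index (N : nat) (th : nat -> 'M[C]_n) : Prop :=
  forall i l : 'I_n, exists f g : {poly C},
    forall j, (j <= N)%N -> g.[j%:R] != 0 /\ th j i l = f.[j%:R] / g.[j%:R].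

Definition vandermonde_condition (N : nat) (th : nat -> 'M[C]_n) : Prop :=
  rational_in_index N th /\
  forall k, (1 <= k <= N)%N ->
    \mxblock_(r < k.+1, s < k.+1) (th s ^+ r : 'M[C]_n) \in unitmx.

End Polynomials.

(* Main.v *)
(* Self-adjointness of P turns its three-term recurrence on the kets into the
   one defining p_k, whence <k|phi_j> = p_k(mu_j) <0|phi_j>, that is
   (e_k, Phi_j) = R_k(j) S(j) with S(j) diagonal, S(j) S(j)^* = D(j) and
   R_0(j) = L(j). The decompositions of theta_j and of the weight follow,
   orthogonality is Parseval's identity in the basis phi, and the values of
   Pi_k are determined by the recurrence that P^n . e_k induces on
   (e_k, Phi_j)(e_0, Phi_j)^-1. *)
Require Import Defs.
From HB Require Import structures.
From mathcomp Require Import all_boot all_order all_algebra.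

Set Implicit Arguments.
Unset Strict Implicit.
Unset Printing Implicit Defensive.

Import Order.TTheory GRing.Theory Num.Theory.
Local Open Scope ring_scope.
Local Open Scope sesquilinear_scope.

(** * Index blocks, polynomials of distinct degrees, interpolation *)

Lemma sum_blocks (T : nmodType) (n k : nat) (F : nat -> T) :
  \sum_(r < k) \sum_(i < n) F (n * r + i)%N = \sum_(x < n * k) F x.
Proof.
rewrite -(big_mkord xpredT F) mulnC big_nat_mul big_mkord.
apply: eq_bigr => r _; rewrite mulSn -{1}[(r * n)%N]add0n.
by rewrite big_addn addnK big_mkord; apply: eq_bigr => i _; rewrite addnC mulnC.
Qed.

Lemma block_bound (n N k i : nat) :
  (k <= N)%N -> (i < n)%N -> (n * k + i < n * N.+1)%N.
Proof.
move=> le_kN lt_in; apply: leq_trans (_ : n * k.+1 <= _)%N.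
  by rewrite mulnS addnC ltn_add2r.
by rewrite leq_mul2l ltnS le_kN orbT.
Qed.

(** The summand of largest degree cannot be cancelled by the others, so its coefficient vanishes; it
    is then dropped and the induction continues. *)
Lemma free_size_polys (F : fieldType) (m : nat) (q : nat -> {poly F})
    (c : nat -> F) :
  (forall i, (i < m)%N -> size (q i) = i.+1) ->
  \sum_(i < m) c i *: q i = 0 -> forall i, (i < m)%N -> c i = 0.
Proof.
elim: m => // m IHm size_q; rewrite big_ord_recr /= => sum0.
have cm0 : c m = 0.
  have /polyP/(_ m) := sum0; rewrite coefD coef0 coef_sum big1 => [|i _].
    rewrite add0r coefZ; have <- : lead_coef (q m) = (q m)`_m.
      by rewrite lead_coefE size_q.
    move/eqP; rewrite mulf_eq0 lead_coef_eq0 -size_poly_eq0 size_q // orbF.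
    by move/eqP.
  by rewrite coefZ nth_default ?mulr0 // size_q // ltnW // ltnS.
move: sum0; rewrite cm0 scale0r addr0 => sum0 i.
rewrite ltnS leq_eqVlt => /orP[/eqP-> // | lt_im].
by apply: IHm => // j lt_jm; apply: size_q; apply: ltnW.
Qed.

Lemma interpolation (C : numFieldType) (m : nat) (y : nat -> C) :
  exists f : {poly C}, forall j, (j < m)%N -> f.[j%:R] = y j.
Proof.
case: m => [|m]; first by exists 0.
have natr_inj : injective (fun k : nat => k%:R : C).
  by move=> i j /eqP; rewrite eqr_nat => /eqP.
have sample := lagrange_sample (ltn0Sn m) natr_inj.
exists (\sum_(i < m.+1)
           y i *: (tnth (m.+1.-lagrange (fun k => k%:R)) i : {poly C})).
move=> j lt_jm; rewrite horner_sum (bigD1 (Ordinal lt_jm)) //=.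
rewrite big1 => [|i /negPf ne_ij]; rewrite hornerZ (sample _ (Ordinal lt_jm)).
  by rewrite eqxx mulr1 addr0.
by rewrite ne_ij mulr0.
Qed.

(** Only finitely many indices are constrained, so each entry is interpolated by a polynomial, with
    denominator 1. *)
Lemma rational_in_indexP (C : numClosedFieldType) (n N : nat)
  (th : nat -> 'M[C]_n) : rational_in_index N th.
Proof.
move=> i l; have [f fP] := interpolation N.+1 (fun j => th j i l).
exists f, 1 => j le_jN; rewrite hornerC oner_neq0 divr1; split=> //.
by rewrite fP.
Qed.

(** * Orthonormal bases and Parseval's identity *)

Section Orthonormal.
Variables (C : numClosedFieldType) (V : vectType C).
Variable ip : {dot V for (@Num.conj C)}.

Lemma ip_conj (u v : V) : (ip u v)^* = ip v u.
Proof. by rewrite [RHS]hermC expr0 mul1r. Qed.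

Lemma orthonormal_nth (s : seq V) (i j : nat) : orthonormal ip s ->
  (i < size s)%N -> (j < size s)%N -> ip s`_i s`_j = (i == j)%:R.
Proof.
by move=> /orthonormalP[s_uniq s_on] lt_i lt_j; rewrite s_on ?mem_nth ?nth_uniq.
Qed.

Lemma parseval (d : nat) (s : d.-tuple V) (u v : V) :
  orthonormal_basis ip s ->
  ip u v = \sum_(x < d) ip u s`_x * (ip v s`_x)^*.
Proof.
case=> s_on s_basis.
(* Coordinates in an orthonormal basis are inner products with the basis vectors. *)
have coordE w (x : 'I_d) : coord s x w = ip w s`_x.
  rewrite [w in RHS](coord_basis s_basis) ?memvf // linear_sumlz /=.
  rewrite (bigD1 x) //= big1 => [|y ne_yx]; rewrite linearZl_LR /=;
    rewrite orthonormal_nth ?size_tuple //.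
    by rewrite eqxx mulr1 addr0.
  by rewrite (inj_eq val_inj) (negPf ne_yx) mulr0.
rewrite [u in LHS](coord_basis s_basis) ?memvf // linear_sumlz /=.
by apply: eq_bigr => x _; rewrite linearZl_LR /= coordE ip_conj.
Qed.

End Orthonormal.

(** * Scalar orthonormal polynomials and the eigenvectors of [P] *)

Lemma size_scalar_polys (C : numClosedFieldType) (d : nat) (a b : nat -> C)
    (p : nat -> {poly C}) :
  scalar_polys d a b p -> (forall k, (1 <= k < d)%N -> a k != 0) ->
  forall k, (k < d)%N -> size (p k) = k.+1.
Proof.
move=> [p0 p_rec] a_neq0 k; have [m] := ubnP k.
elim: m k => // m IHm [_ _|k]; first by rewrite p0 size_poly1.
rewrite ltnS => lt_km lt_kd.
have sz_k : size (p k) = k.+1 by apply: IHm => //; apply: ltnW.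
have acN0 : (a k.+1)^* != 0 by rewrite conjC_eq0 a_neq0.
have sz_lead : size (('X - (b k)%:P) * p k) = k.+2.
  rewrite mulrC size_Mmonic ?monicXsubC -?size_poly_eq0 ?sz_k //.
  by rewrite size_XsubC addn2.
(* Scaling by the nonzero [(a k.+1)^*] keeps the size, and [('X - (b k)%:P) * p k] outgrows the
   [prev_term] summand. *)
rewrite -(size_scale _ acN0) p_rec // size_polyDl // size_polyN sz_lead.
apply: leq_ltn_trans (size_scale_leq _ _) _.
clear acN0 sz_k sz_lead; case: k lt_km lt_kd => [|k] lt_km lt_kd /=.
  by rewrite size_poly0.
by rewrite IHm // ltnW // ltnW.
Qed.

Section Spectral.
Variables (C : numClosedFieldType) (V : vectType C).
Variables (ip : {dot V for (@Num.conj C)}) (d : nat) (ket phi : d.-tuple V).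
Variables (P : 'End(V)) (a b mu : nat -> C) (p : nat -> {poly C}).
Hypothesis P_adj : self_adjoint ip P.
Hypothesis P_ket : forall k, (k < d)%N ->
  P ket`_k = (a k.+1)^* *: ket`_k.+1 + b k *: ket`_k
             + a k *: prev_term (fun k' => ket`_k') k.
Hypothesis a_neq0 : forall k, (1 <= k < d)%N -> a k != 0.
Hypothesis phi_on : orthonormal ip phi.
Hypothesis phi_eigen : forall j, (j < d)%N -> P phi`_j = mu j *: phi`_j.
Hypothesis p_rec : scalar_polys d a b p.

Lemma eigen_real j : (j < d)%N -> (mu j)^* = mu j.
Proof.
move=> lt_jd; have := P_adj phi`_j phi`_j.
rewrite phi_eigen // linearZl_LR linearZr_LR /= orthonormal_nth ?size_tuple //.
by rewrite eqxx !mulr1.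
Qed.

Lemma ip_iter m u j : (j < d)%N ->
  ip (iter m P u) phi`_j = ip u phi`_j * mu j ^+ m.
Proof.
move=> lt_jd; elim: m => [|m IHm] /=; first by rewrite expr0 mulr1.
by rewrite P_adj phi_eigen // linearZr_LR /= eigen_real // IHm exprS mulrCA.
Qed.

Lemma ket_phiE k j : (k < d)%N -> (j < d)%N ->
  ip ket`_k phi`_j = (p k).[mu j] * ip ket`_0 phi`_j.
Proof.
move=> lt_kd lt_jd; case: p_rec => p0 pS.
have [m] := ubnP k; elim: m k lt_kd => // m IHm [_ _|k lt_kd].
  by rewrite p0 hornerC mul1r.
rewrite ltnS => lt_km.
have acN0 : (a k.+1)^* != 0 by rewrite conjC_eq0 a_neq0.
apply: (mulfI acN0).
rewrite mulrA -hornerZ pS // !hornerE mulrBl -!mulrA.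
have -> : (prev_term p k).[mu j] * ip ket`_0 phi`_j
          = ip (prev_term (fun k' => ket`_k') k) phi`_j.
  clear acN0; case: k lt_kd lt_km => [|k] lt_kd lt_km /=.
    by rewrite horner0 mul0r linear0l.
  by rewrite -IHm // ltnW // ltnW.
have := P_adj ket`_k phi`_j.
rewrite P_ket 1?ltnW // phi_eigen // !linearDl !linearZl_LR linearZr_LR /=.
rewrite eigen_real //.
rewrite (IHm k) // 1?ltnW // => eqP.
by rewrite mulrBl -eqP addrAC !addrK.
Qed.

End Spectral.

(** * Block Vandermonde matrices and the matrix recurrence *)

Section MatrixFacts.
Variable C : numClosedFieldType.

Lemma exp_mulmx_diag (n : nat) (th L : 'M[C]_n) (d : 'rV[C]_n) (r : nat) :
  th *m L = L *m diag_mx d ->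
  th ^+ r *m L = L *m diag_mx (\row_l d 0 l ^+ r).
Proof.
move=> thL; elim: r => [|r IHr].
  rewrite expr0 mul1mx -[LHS]mulmx1; congr (_ *m _).
  by apply/matrixP => i l; rewrite !mxE expr0.
rewrite exprSr -[_ * _]/(_ *m _) -mulmxA thL mulmxA IHr -mulmxA mulmx_diag.
by congr (_ *m diag_mx _); apply/rowP => l; rewrite !mxE exprSr.
Qed.

(* A row vector (c_{r,i}) killing every column block yields the polynomial
   \sum_(r, i) c_{r,i} p_i X^(nr), which has more roots than its degree; its
   summands have pairwise distinct degrees nr + i. *)
Lemma block_vandermonde_unit (n k : nat) (p : nat -> {poly C}) (mu : nat -> C)
    (th : nat -> 'M[C]_n) :
  (forall i, (i < n)%N -> size (p i) = i.+1) ->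
  {in [pred x | (x < n * k.+1)%N] &, injective mu} ->
  (forall s, (s <= k)%N ->
     th s *m alternant n p mu s = alternant n p mu s *m eigen_mx n mu s) ->
  \mxblock_(r < k.+1, s < k.+1) (th s ^+ r : 'M[C]_n) \in unitmx.
Proof.
move=> size_p mu_inj thL; rewrite -row_free_unit; apply: inj_row_free => u.
(* For [n = 0] the vector [u] has no entries; otherwise [n = m.+1], so division by [n] and [inord]
   make sense. *)
case: n th size_p mu_inj thL u => [|m] th size_p mu_inj thL u u0.
  by apply/mxrowP => r; apply/rowP => -[].
(* The pair (r, i) is encoded as x = nr + i, so that [q x] has degree exactly x. *)
pose c (r i : nat) : C := submxrow u (inord r : 'I_k.+1) 0 (inord i : 'I_m.+1).
pose q x := p (x %% m.+1)%N * 'X^(m.+1 * (x %/ m.+1)).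
pose d x := c (x %/ m.+1)%N (x %% m.+1)%N.
have size_q x : size (q x) = x.+1.
  have sz : size (p (x %% m.+1)%N) = (x %% m.+1).+1.
    by rewrite size_p // ltn_pmod.
  rewrite size_mulXn -?size_poly_eq0 sz // addnS mulnC -divn_eq //.
have q_root x : (x < m.+1 * k.+1)%N ->
    root (\sum_(y < m.+1 * k.+1) d y *: q y) (mu x).
  move=> lt_x; rewrite (divn_eq x m.+1) [(_ * m.+1)%N]mulnC.
  have lt_xk : (x %/ m.+1 < k.+1)%N by rewrite ltn_divLR // mulnC.
  have lt_xm : (x %% m.+1 < m.+1)%N by rewrite ltn_pmod.
  (* Column block s = x / n of the product is multiplied on the right by the alternant at s, which
     turns [th s ^+ r] into the powers [mu x ^+ (n * r)]; entry x mod n is then the value of the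
     polynomial at [mu x]. *)
  move: u0; rewrite -[u]submxrowK mul_mxrow_mxblock -mxrow0.
  move/eq_mxrowP/(_ (Ordinal lt_xk)) => /=.
  move/(congr1 (mulmx^~ (alternant m.+1 p mu (x %/ m.+1)))).
  move/rowP/(_ (Ordinal lt_xm)); rewrite mul0mx mulmx_suml summxE [RHS]mxE.
  move=> sum0.
  apply/rootP; rewrite horner_sum.
  rewrite -(sum_blocks m.+1 k.+1 (fun y => (d y *: q y).[_])) -[RHS]sum0.
  apply: eq_bigr => r _; rewrite -mulmxA (exp_mulmx_diag _ (thL _ lt_xk)).
  rewrite mxE; apply: eq_bigr => i _.
  rewrite mul_mx_diag !mxE /d /q hornerZ hornerM hornerXn.
  have -> : ((m.+1 * r + i) %/ m.+1 = r)%N.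
    by rewrite mulnC divnMDl // divn_small ?addn0.
  have -> : ((m.+1 * r + i) %% m.+1 = i)%N.
    by rewrite mulnC modnMDl modn_small.
  by rewrite /c !inord_val mxE exprM.
(* There are n(k+1) distinct roots, while every summand has degree below n(k+1). *)
have sum0 : \sum_(y < m.+1 * k.+1) d y *: q y = 0.
  apply: (@roots_geq_poly_eq0 _ _ [seq mu x | x <- iota 0 (m.+1 * k.+1)]).
  - by apply/allP => _ /mapP[x + ->]; rewrite mem_iota => /q_root.
  - rewrite map_inj_in_uniq ?iota_uniq // => x y.
    by rewrite !mem_iota; apply: mu_inj.
  rewrite size_map size_iota; apply: leq_trans (size_sum _ _ _) _.
  apply/bigmax_leqP => y _; apply: leq_trans (size_scale_leq _ _) _.
  by rewrite size_q.
have d0 := free_size_polys (fun x _ => size_q x) sum0.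
apply/mxrowP => r; rewrite submxrow0; apply/rowP => i.
have le_rk : (r <= k)%N by rewrite -ltnS.
have := d0 _ (block_bound le_rk (ltn_ord i)).
rewrite /d mulnC divnMDl // divn_small // addn0 modnMDl modn_small //.
by rewrite /c !inord_val mxE => ->; rewrite mxE.
Qed.

(** Both sequences start at the identity, and invertibility of [(A k.+1)^t*] lets the recurrence
    determine each term from the two before it. *)
Lemma matrix_polys_unique (n N : nat) (A B th : nat -> 'M[C]_n)
    (M : nat -> nat -> 'M[C]_n) (X : nat -> 'M[C]_n) (j : nat) :
  matrix_polys N A B th M ->
  (forall k, (1 <= k <= N)%N -> A k \in unitmx) ->
  (j <= N)%N -> X 0 = 1%:M ->
  (forall k, (k < N)%N ->
     (A k.+1)^t* *m X k.+1 + B k *m X k + A k *m prev_term X k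
     = X k *m th j) ->
  forall k, (k <= N)%N -> Pi M k (th j) = X k.
Proof.
move=> [_ M00 PiS] A_unit le_jN X0 XS k; have [m] := ubnP k.
elim: m k => // m IHm [_ _|k].
  by rewrite /Pi big_ord1 expr0 M00 X0 mulmx1.
rewrite ltnS => lt_km lt_kN.
have At_unit : (A k.+1)^t* \in unitmx by rewrite map_unitmx unitmx_tr A_unit.
apply: (can_inj (mulKmx At_unit)).
have := PiS k j (ltnW lt_kN) le_jN; rewrite lt_kN (IHm k) ?(ltnW lt_kN) //.
have -> : prev_term (fun k' => Pi M k' (th j)) k = prev_term X k.
  clear At_unit; case: k lt_km lt_kN => //= k lt_km lt_kN.
  by rewrite IHm // ltnW // ltnW.
by rewrite -XS // => /addIr/addIr.
Qed.

End MatrixFacts.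

(** * The matrix valued inner product *)

Section MatrixInnerProduct.
Variables (C : numClosedFieldType) (V : vectType C) (n : nat).
Variable ip : {dot V for (@Num.conj C)}.
Implicit Types v w : {ffun 'I_n -> V}.

Lemma mxipDl v1 v2 w : mxip ip (v1 + v2) w = mxip ip v1 w + mxip ip v2 w.
Proof. by apply/matrixP => i l; rewrite !mxE ffunE linearDl. Qed.

Lemma mxip_act A v w : mxip ip (mxact A v) w = A *m mxip ip v w.
Proof.
apply/matrixP => i l; rewrite !mxE ffunE linear_sumlz /=.
by apply: eq_bigr => x _; rewrite linearZl_LR mxE.
Qed.

Lemma mxip0l w : mxip ip 0 w = 0.
Proof. by apply/matrixP => i l; rewrite !mxE ffunE linear0l. Qed.

End MatrixInnerProduct.

(** * Blocks of basis vectors and of eigenvectors *)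

Section BlockSpectral.
Variables (C : numClosedFieldType) (V : vectType C) (n N : nat).
Variable ip : {dot V for (@Num.conj C)}.
Variables ket phi : (n * N.+1).-tuple V.
Variables (P : 'End(V)) (a b mu : nat -> C) (p : nat -> {poly C}).
Hypothesis P_adj : self_adjoint ip P.
Hypothesis P_ket : forall k, (k < n * N.+1)%N ->
  P ket`_k = (a k.+1)^* *: ket`_k.+1 + b k *: ket`_k
             + a k *: prev_term (fun k' => ket`_k') k.
Hypothesis a_neq0 : forall k, (1 <= k < n * N.+1)%N -> a k != 0.
Hypothesis phi_on : orthonormal ip phi.
Hypothesis phi_eigen : forall j, (j < n * N.+1)%N -> P phi`_j = mu j *: phi`_j.
Hypothesis p_rec : scalar_polys (n * N.+1) a b p.

Let E k j := mxip ip (vblock n ket k) (vblock n phi j).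
Let S j : 'M[C]_n := diag_mx (\row_l ip ket`_0 phi`_(n * j + l)).

Lemma eigen_mx_adj j : (j <= N)%N -> (eigen_mx n mu j)^t* = eigen_mx n mu j.
Proof.
move=> le_jN; rewrite tr_diag_mx map_diag_mx; congr diag_mx.
by apply/rowP => l; rewrite !mxE rmorphXn /= (eigen_real P_adj phi_on phi_eigen)
  // block_bound.
Qed.

Lemma mxip_vblock k j : (k <= N)%N -> (j <= N)%N ->
  E k j = Rmx n p mu k j *m S j.
Proof.
move=> le_kN le_jN; rewrite mul_mx_diag; apply/matrixP => i l.
rewrite !mxE !ffunE (ket_phiE P_adj P_ket a_neq0 phi_on phi_eigen p_rec) //;
  exact: block_bound.
Qed.

Lemma mxip_vblock0 j : (j <= N)%N -> E 0 j = alternant n p mu j *m S j.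
Proof.
move=> le_jN; rewrite mxip_vblock //; congr (_ *m _).
by apply/matrixP => i l; rewrite !mxE muln0.
Qed.

(** Self-adjointness moves [iter n P] to the second argument, which indexes columns; the eigenvalues
    therefore multiply on the right. *)
Lemma mxip_iterP k j : (j <= N)%N ->
  mxip ip (compwise (iter n P) (vblock n ket k)) (vblock n phi j)
  = E k j *m eigen_mx n mu j.
Proof.
move=> le_jN; rewrite mul_mx_diag; apply/matrixP => i l; rewrite !mxE !ffunE.
by rewrite (ip_iter P_adj phi_on phi_eigen) ?block_bound.
Qed.

Lemma weight_diagE j : weight_diag ip n ket phi j = S j *m (S j)^t*.
Proof.
rewrite tr_diag_mx map_diag_mx mulmx_diag; congr diag_mx.
by apply/rowP => l; rewrite !mxE /weight normCK.
Qed.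

End BlockSpectral.

Theorem proposition3p11 (R : realType) (n N : nat) (n_gt0 : (0 < n)%N)
  (V : vectType R[i]) (ip : {dot V for (@Num.conj R[i])})
  (dimV : \dim {:V} = (n * N.+1)%N)
  (ket phi : (n * N.+1).-tuple V)
  (H P : 'End(V))
  (a b mu : nat -> R[i])
  (p : nat -> {poly R[i]})
  (A B : nat -> 'M[R[i]]_n)
  (M : nat -> nat -> 'M[R[i]]_n)
  (ket_basis : orthonormal_basis ip ket)
  (H_adj : self_adjoint ip H)
  (ket_eigen : forall k, (k < n * N.+1)%N ->
     exists lambda : R[i], H ket`_k = lambda *: ket`_k)
  (P_adj : self_adjoint ip P)
  (P_ket : forall k, (k < n * N.+1)%N ->
     P ket`_k = (a k.+1)^* *: ket`_k.+1 + b k *: ket`_k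
                + a k *: prev_term (fun k' => ket`_k') k)
  (a_neq0 : forall k, (1 <= k < n * N.+1)%N -> a k != 0)
  (phi_basis : orthonormal_basis ip phi)
  (phi_eigen : forall j, (j < n * N.+1)%N -> P phi`_j = mu j *: phi`_j)
  (phi_phase : forall j, (j < n * N.+1)%N ->
     ip ket`_0 phi`_j = sqrtC (weight ip ket phi j))
  (p_rec : scalar_polys (n * N.+1) a b p)
  (Pn_e : forall k, (k <= N)%N ->
     compwise (iter n P) (vblock n ket k)
     = mxact ((A k.+1)^t*) (vblock n ket k.+1) + mxact (B k) (vblock n ket k)
       + mxact (A k) (prev_term (vblock n ket) k))
  (B_adj : forall k, (k <= N)%N -> (B k)^t* = B k)
  (A_unit : forall k, (1 <= k <= N)%N -> A k \in unitmx)
  (e0Phi_unit : forall j, (j <= N)%N ->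
     mxip ip (vblock n ket 0) (vblock n phi j) \in unitmx)
  (Pi_rec : matrix_polys N A B (theta_mx ip n ket phi mu) M)
  (mu_distinct : forall i j, (i < n * N.+1)%N -> (j < n * N.+1)%N ->
     i != j -> mu i != mu j) :
  let L := alternant n p mu in
  let D := weight_diag ip n ket phi in
  [/\ forall j, (j <= N)%N -> L j \in unitmx,
      (forall j, (j <= N)%N ->
         theta_mx ip n ket phi mu j = L j *m eigen_mx n mu j *m invmx (L j))
      /\ vandermonde_condition N (theta_mx ip n ket phi mu),
      forall j, (j <= N)%N ->
        weight_mx ip n ket phi j = L j *m D j *m (L j)^t*,
      forall k m, (k <= N)%N -> (m <= N)%N ->
        \sum_(j < N.+1) Rmx n p mu k j *m D j *m (Rmx n p mu m j)^t*
        = ((k == m)%:R)%:M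
    & forall k j, (k <= N)%N -> (j <= N)%N ->
        Pi M k (theta_mx ip n ket phi mu j) = Rmx n p mu k j *m invmx (L j)].
Proof.
move=> L D; set th := theta_mx ip n ket phi mu in Pi_rec *.
have [[ket_on _] [phi_on _]] := (ket_basis, phi_basis).
pose E k j := mxip ip (vblock n ket k) (vblock n phi j).
pose S j : 'M[R[i]]_n := diag_mx (\row_l ip ket`_0 phi`_(n * j + l)).
have ER k j : (k <= N)%N -> (j <= N)%N -> E k j = Rmx n p mu k j *m S j.
  exact: (mxip_vblock P_adj P_ket a_neq0 phi_on phi_eigen p_rec).
have EL j : (j <= N)%N -> E 0 j = L j *m S j.
  exact: (mxip_vblock0 P_adj P_ket a_neq0 phi_on phi_eigen p_rec).
(* [L j] is a factor of the invertible square matrix [E 0 j]. *)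
have L_unit j : (j <= N)%N -> L j \in unitmx.
  move=> le_jN; have := e0Phi_unit j le_jN.
  by rewrite -/(E 0 j) EL // unitmx_mul => /andP[].
(* Since [E 0 j = L j *m S j] and the diagonal [S j] commutes with [eigen_mx n mu j], the factor
   [S j] drops out of the conjugation. *)
have thE j : (j <= N)%N -> th j = L j *m eigen_mx n mu j *m invmx (L j).
  move=> le_jN; apply: (canLR (mulmxK (e0Phi_unit j le_jN))).
  rewrite (eigen_mx_adj P_adj phi_on phi_eigen) // -/(E 0 j) EL // -!mulmxA.
  by rewrite mulKmx ?L_unit // diag_mxC.
have thL j : (j <= N)%N -> th j *m L j = L j *m eigen_mx n mu j.
  by move=> le_jN; rewrite thE // mulmxKV ?L_unit.
split=> //.
- split=> //; split=> [|k /andP[_ le_kN]]; first exact: rational_in_indexP.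
  have le_nk : (n * k.+1 <= n * N.+1)%N by rewrite leq_mul2l ltnS le_kN orbT.
  apply: (block_vandermonde_unit (p := p) (mu := mu))
    => [i lt_in|x y lt_x lt_y|s le_sk].
  + apply: (size_scalar_polys p_rec a_neq0).
    exact: leq_trans lt_in (leq_pmulr n _).
  + move=> eq_mu; apply/eqP; apply: contraT => ne_xy.
    by rewrite -(negPf (mu_distinct x y _ _ ne_xy)) ?eq_mu ?eqxx //;
      apply: leq_trans le_nk.
  + exact/thL/(leq_trans le_sk).
- move=> j le_jN; rewrite /weight_mx -/(E 0 j) EL // /D weight_diagE.
  by rewrite trmx_mul map_mxM !mulmxA.
- move=> k m le_kN le_mN; apply/matrixP => i l.
  have -> : \sum_(j < N.+1) Rmx n p mu k j *m D j *m (Rmx n p mu m j)^t*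
            = \sum_(j < N.+1) E k j *m (E m j)^t*.
    apply: eq_bigr => j _; have le_jN : (j <= N)%N by rewrite -ltnS.
    by rewrite !ER // /D weight_diagE trmx_mul map_mxM !mulmxA.
  rewrite summxE.
  (* Summing over j and over the columns of each block runs once through the whole basis [phi], so
     Parseval applies. *)
  transitivity (ip ket`_(n * k + i) ket`_(n * m + l)).
    rewrite (parseval _ _ phi_basis) -(sum_blocks n N.+1
      (fun x => ip ket`_(n * k + i) phi`_x * (ip ket`_(n * m + l) phi`_x)^*)).
    apply: eq_bigr => j _; rewrite mxE.
    by apply: eq_bigr => x _; rewrite !mxE !ffunE.
  rewrite orthonormal_nth ?size_tuple ?block_bound // !mxE -mulrnA mulnb.
  (* nk + i = nm + l forces k = m and i = l, by uniqueness of quotient and remainder modulo n. *)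
  congr (_%:R); congr nat_of_bool; apply/eqP/andP => [eq_x|[/eqP-> /eqP->//]].
  have := congr1 (divn^~ n) eq_x; have := congr1 (modn^~ n) eq_x.
  rewrite /= !(mulnC n) !modnMDl !modn_small // !divnMDl // !divn_small //.
  by rewrite !addn0 => eq_il ->; split=> //; apply/eqP/val_inj.
- move=> k j le_kN le_jN.
  have E_unit : E 0 j \in unitmx := e0Phi_unit j le_jN.
  (* The common right factor [S j] cancels in the quotient, leaving an expression to which the
     recurrence for P^n applies. *)
  have RE k' : (k' <= N)%N ->
      Rmx n p mu k' j *m invmx (L j) = E k' j *m invmx (E 0 j).
    move=> le_k'N; apply: (canRL (mulmxK E_unit)).
    by rewrite EL // ER // mulmxA mulmxKV ?L_unit.
  rewrite RE //; move: k le_kN.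
  apply: (matrix_polys_unique (X := fun k => E k j *m invmx (E 0 j)) Pi_rec)
    => // [|k lt_kN]; first exact: mulmxV.
  (* Pairing the recurrence of P^n with Phi_j and multiplying on the right by the inverse of [E 0 j]
     turns the eigenvalue factor into [th j]. *)
  have := congr1 (fun v => mxip ip v (vblock n phi j)) (Pn_e k (ltnW lt_kN)).
  rewrite /= (mxip_iterP _ P_adj phi_on phi_eigen) // !mxipDl !mxip_act.
  rewrite -/(E k j) -/(E k.+1 j) => eqE.
  rewrite /th /theta_mx (eigen_mx_adj P_adj phi_on phi_eigen) // -/(E 0 j).
  rewrite !mulmxA mulmxKV // eqE !mulmxDl; congr (_ + _).
  rewrite -mulmxA; congr (_ *m _).
  (* At k = 0 the preceding block is zero, and so is its inner product. *)
  by case: (k) => [|k'] //=; rewrite mxip0l mul0mx.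
Qed.
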